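(* Let $(g_n)_{n\ge 1}$ be a sequence of functions $g_n:\{0,1\}^n\to\{YES,NO\}$ such that (1) for every stationary and ergodic binary Markov chain $\{X_n\}$ of arbitrary finite order, $$\lim_{n\to\infty}P(g_n(X_1,\dots,X_n)=YES)=1;$$ (2) for every stationary and ergodic binary process $\{X_n\}$ that is not finitarily Markovian, $$\lim_{n\to\infty}P(g_n(X_1,\dots,X_n)=NO)=1.$$ Then there exists a single stationary and ergodic binary process $\{X_n\}$ such that $$\limsup_{n\to\infty}P(g_n(X_1,\dots,X_n)=YES)=1\quad\text{and}\quad \limsup_{n\to\infty}P(g_n(X_1,\dots,X_n)=NO)=1.$$
   Context: A binary process (binary time series) is a sequence of $\{0,1\}$-valued random variables $\{X_n\}_{n=1}^\infty$. A one-sided stationary process is always regarded as extended to a two-sided stationary process $\{X_n\}_{n=-\infty}^\infty$. For $m\le n$ write $X_m^n=(X_m,\dots,X_n)$, and similarly for deterministic sequences. A binary process is a Markov chain of finite order if for some integer $k\ge 0$ the conditional distribution of the next symbol given the past depends only on the last $k$ symbols ($k=0$ meaning independence of the past). Chains of all finite orders, mixing or not, are considered. A stationary and ergodic binary process $\{X_n\}$ is finitarily Markovian if for almost every past $x_{-\infty}^{-1}$ (with respect to the distribution of $X_{-\infty}^{-1}$) there is a finite $K=K(x_{-\infty}^{-1})$ such that for all $i>0$ and all $y_{-i}^{-1}\in\{0,1\}^i$: if $P(X_0=1\mid X_{-K-i}^{-K-1}=y_{-i}^{-1},\,X_{-K}^{-1}=x_{-K}^{-1})>0$ (in particular, the conditioning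 event has positive probability), then $$P(X_0=1\mid X_{-K}^{-1}=x_{-K}^{-1})=P(X_0=1\mid X_{-K-i}^{-K-1}=y_{-i}^{-1},\,X_{-K}^{-1}=x_{-K}^{-1}).$$ *)

(* Defs.v *)
From HB Require Import structures.
From mathcomp Require Import all_boot all_order all_algebra.
From mathcomp Require Import all_classical all_reals all_analysis.

Set Implicit Arguments.
Unset Strict Implicit.
Unset Printing Implicit Defensive.

Import Order.TTheory GRing.Theory Num.Theory.

Local Open Scope classical_set_scope.
Local Open Scope ring_scope.

Inductive answer := YES | NO.

Definition bipath := int -> bool.

Definition time_shift (x : bipath) : bipath := fun m => x (m + 1).

(* Membership in the product sigma-algebra of {0,1}^Z. *)
Definition measurable_path (A : set bipath) : Prop :=
  <<s [set [set x : bipath | x m = b] | m in [set: int] & b in [set: bool]] >> A.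

(* P(A | B); it is 0 when P(B) = 0, so uses are guarded by 0 < P(B). *)
Definition condP (R : realType) (d : measure_display) (T : measurableType d)
    (P : probability T R) (A B : set T) : R :=
  fine (P (A `&` B)) / fine (P B).

(* Processes are indexed by int because a stationary process is always taken
   in its two-sided extension. *)
Section processes.
Context (R : realType) (d : measure_display) (T : measurableType d).
Variables (P : probability T R) (X : int -> {RV P >-> bool}).

(* The block (X_m, ..., X_{m+n-1}), in increasing order of time. *)
Definition block (m : int) (n : nat) (w : T) : n.-tuple bool :=
  [tuple X (m + i%:Z) w | i < n].

Definition block_is (m : int) (n : nat) (s : n.-tuple bool) : set T :=
  [set w | block m n w = s].

Definition stationary : Prop :=
  forall (m : int) (n : nat) (s : n.-tuple bool),
    P (block_is (m + 1) s) = P (block_is m s).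

Definition ergodic : Prop :=
  forall A : set bipath, measurable_path A -> time_shift @^-1` A = A ->
    P [set w | A (fun m => X m w)] = 0%E \/ P [set w | A (fun m => X m w)] = 1%E.

(* The law of X_n given a past block y x, with x = (x_{n-k}, ..., x_{n-1})
   and y the i symbols before x, is its law given x alone. *)
Definition markov_order (k : nat) : Prop :=
  forall (n : int) (i : nat) (y : i.-tuple bool) (x : k.-tuple bool) (b : bool),
    let E := block_is (n - k%:Z) x in
    let F := block_is (n - (k + i)%N%:Z) y in
    (0 < P (F `&` E))%E ->
    condP P [set w | X n w = b] (F `&` E) = condP P [set w | X n w = b] E.

Definition finite_order_markov : Prop := exists k : nat, markov_order k.

(* The sample point w supplies the past x_{-j} = X_{-j}(w), so "almost every
   past" under the law of (X_j)_{j < 0} is "almost every w" under P. *)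
Definition finitarily_markovian : Prop :=
  {ae P, forall w : T, exists K : nat,
    forall (i : nat) (y : i.-tuple bool), (0 < i)%N ->
      let E := block_is (- K%:Z) (block (- K%:Z) K w) in
      let F := block_is (- (K + i)%N%:Z) y in
      (0 < P (F `&` E))%E ->
      0 < condP P [set v | X 0 v = true] (F `&` E) ->
      condP P [set v | X 0 v = true] E
        = condP P [set v | X 0 v = true] (F `&` E)}.

Definition prob_answer (g : forall n : nat, n.-tuple bool -> answer)
    (a : answer) (n : nat) : \bar R :=
  P [set w | g n (block 1 n w) = a].

End processes.

(* Main.v *)
Require Import Defs.
From HB Require Import structures.
From mathcomp Require Import all_boot all_order all_algebra.
From mathcomp Require Import all_classical all_reals all_analysis.
From mathcomp Require Import zify lra.
Set Implicit Arguments.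
Unset Strict Implicit.
Unset Printing Implicit Defensive.
Import Order.TTheory GRing.Theory Num.Theory.
Local Open Scope classical_set_scope.
Local Open Scope ring_scope.

(** The process is found by a Baire category argument inside one measure
    preserving system, the dyadic odometer: the 2-adic integers with Haar measure
    and the rotation x |-> x + 1.  Every measurable f from the odometer to bool
    gives a process X_m = f (x + m), which is stationary and ergodic because it
    is a factor of the odometer ([stationary_factor], [ergodic_factor]).  Two
    such functions f and f' that differ on a set of measure d give processes
    whose n-block laws differ by at most n d ([pr_block_close]), so a strict
    lower bound on the probability of a given answer at a given time is an open
    condition on f for the distance P(f <> f').

    Call f periodic if it depends only on x modulo some 2^k.  A periodic f
    yields a periodic process, which is a Markov chain of order 2^k
    ([periodic_markov]), so on it the answer is eventually YES with probability
    close to 1.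

    Limits of periodic functions are rigid: X_0 is close in probability to
    X_{-2^k} for suitable large k.  If moreover every finite word has positive
    probability, the process is not finitarily Markovian: a finite past after
    which the conditional probability p of a 1 does not react to longer pasts
    would make X_0 independent of X_{-2^k} given that past, with 0 < p < 1,
    which contradicts rigidity ([rigid_not_finitarily_markovian]).  Any periodic
    f can be changed on an arbitrarily small set, staying periodic, so that a
    prescribed word appears ([insert_word]); by [baire] the rigid functions of
    full support come arbitrarily close to every periodic f
    ([full_support_dense]).  On them the answer is eventually NO with
    probability close to 1, and this persists for a nearby periodic function.

    Hence for each i both conditions `some time n >= i has answer YES
    (respectively NO) with probability above 1 - 1/(i+1)' are open, and each can
    be met by an arbitrarily small periodic change of a periodic function.  A
    second use of [baire] gives an f that satisfies all of them. *)

(** * Dyadic integers, their residues and their rotation *)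

(** A point x of {0,1}^N is read as the 2-adic integer with binary digits x_0,
    x_1, ...; this is its residue modulo 2^k. *)
Fixpoint res (k : nat) (x : nat -> bool) : nat :=
  if k is k'.+1 then (res k' x + x k' * 2 ^ k')%N else 0%N.

Definition wrap (k : nat) (z : int) : nat := `|(z %% (2 ^ k)%N%:Z)%Z|%N.

Lemma pow2_neq0 k : (2 ^ k)%N%:Z != 0.
Proof. by rewrite -lt0n expn_gt0. Qed.

Lemma wrapE k z : (wrap k z)%:Z = (z %% (2 ^ k)%N%:Z)%Z.
Proof. by rewrite /wrap gez0_abs// modz_ge0// pow2_neq0. Qed.

Lemma wrap_lt k z : (wrap k z < 2 ^ k)%N.
Proof. by rewrite -ltz_nat wrapE ltz_pmod// ltz_nat expn_gt0. Qed.

Lemma wrap_nat k n : wrap k n%:Z = (n %% 2 ^ k)%N.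
Proof. by rewrite /wrap modz_nat. Qed.

Lemma wrapDl k y z : wrap k ((wrap k y)%:Z + z) = wrap k (y + z).
Proof. by rewrite /wrap -/(wrap k y) wrapE modzDml. Qed.

Lemma wrap_mod j k z : (j <= k)%N -> (wrap k z %% 2 ^ j)%N = wrap j z.
Proof.
move=> jk; rewrite -wrap_nat /wrap -/(wrap k z) wrapE; congr (`|_|%N).
apply/eqP; rewrite eqz_mod_dvd {2}(divz_eq z (2 ^ k)%N) opprD addrCA subrr addr0.
by rewrite dvdzE abszN abszM dvdn_mull// dvdn_exp2l.
Qed.

Lemma res_lt k x : (res k x < 2 ^ k)%N.
Proof. by elim: k => //= k IH; rewrite expnS; case: (x k); lia. Qed.

Lemma res_mod j k x : (j <= k)%N -> (res k x %% 2 ^ j)%N = res j x.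
Proof.
elim: k => [|k IH]; first by rewrite leqn0 => /eqP ->; rewrite modn1.
rewrite leq_eqVlt => /predU1P[->|]; first by rewrite modn_small// res_lt.
rewrite ltnS => jk /=; rewrite -(subnK jk) expnD mulnA addnC modnMDl.
by rewrite subnK ?IH.
Qed.

Lemma bit_res k x : x k = odd (res k.+1 x %/ 2 ^ k).
Proof.
rewrite /= addnC divnMDl ?expn_gt0// divn_small ?res_lt//= addn0.
by case: (x k).
Qed.

Lemma eq_from_res x y : (forall k, res k x = res k y) -> x = y.
Proof. by move=> xy; apply/funext => k; rewrite (bit_res k x) (bit_res k y) xy. Qed.

Definition cylinder (k r : nat) : set (nat -> bool) := [set x | res k x = r].

Definition cylinders : set (set (nat -> bool)) :=
  [set A | A = set0 \/ exists k r, (r < 2 ^ k)%N /\ A = cylinder k r].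

(** Residues modulo 2^k determine those modulo 2^j for j <= k, so two cylinders
    are nested or disjoint. *)
Lemma setI_closed_cylinders : setI_closed cylinders.
Proof.
have sub j k r s : (j <= k)%N ->
    cylinder k s `&` cylinder j r = cylinder k s \/
    cylinder k s `&` cylinder j r = set0.
  move=> jk; have [e|ne] := eqVneq (s %% 2 ^ j)%N r; [left|right].
    by apply/seteqP; split=> x [] //= xs; split=> //;
      rewrite /cylinder/= -(res_mod x jk) xs.
  by apply/seteqP; split=> x [] //= xs xr; move: ne;
    rewrite -(xs : res k x = s) res_mod// (xr : res j x = r) eqxx.
move=> A B [->|[j [r [rj ->]]]]; first by left; rewrite set0I.
move=> [->|[k [s [sk ->]]]]; first by left; rewrite setI0.
have [jk|/ltnW kj] := leqP j k.
  by rewrite setIC; have [->|->] := sub j k r s jk; [right; exists k, s|left].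
by have [->|->] := sub k j s r kj; [right; exists j, r|left].
Qed.

(** Bernoulli space with its product sigma-algebra; cylinders are indexed by
    residues rather than by words because the rotation permutes residues. *)
Definition odometer := g_sigma_algebraType cylinders.

(** Addition of the integer m with carry: digit i of x + m is read off the
    residue of x + m modulo 2^(i+1). *)
Definition rot (m : int) (x : odometer) : odometer :=
  fun i => odd (wrap i.+1 ((res i.+1 x)%:Z + m) %/ 2 ^ i).

Lemma res_rot k m x : res k (rot m x) = wrap k ((res k x)%:Z + m).
Proof.
elim: k => [|k IH].
  by have := wrap_lt 0 ((res 0 x)%:Z + m); rewrite expn0 ltnS leqn0 => /eqP ->.
rewrite -[LHS]/(res k (rot m x) + rot m x k * 2 ^ k)%N IH /rot.
set N := wrap k.+1 _.
have : (N %/ 2 ^ k < 2)%N by rewrite ltn_divLR ?expn_gt0// -expnS wrap_lt.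
have -> : wrap k ((res k x)%:Z + m) = (N %% 2 ^ k)%N.
  by rewrite wrap_mod// -[RHS]wrapDl wrap_nat res_mod.
rewrite addnC [RHS](divn_eq N (2 ^ k)); move: (N %/ 2 ^ k)%N => q.
by case: q => [|[|]].
Qed.

Lemma rotD m n x : rot m (rot n x) = rot (m + n) x.
Proof.
by apply: eq_from_res => k; rewrite !res_rot wrapDl -addrA (addrC n).
Qed.

Lemma res_rot_eq k m r x : (r < 2 ^ k)%N ->
  (res k (rot m x) == r) = (res k x == wrap k (r%:Z - m)).
Proof.
move=> rk; rewrite res_rot; apply/eqP/eqP => [<-|->].
  by rewrite wrapDl addrK wrap_nat modn_small// res_lt.
by rewrite wrapDl subrK wrap_nat modn_small.
Qed.

Lemma measurable_cylinder k r : measurable (cylinder k r : set odometer).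
Proof.
have [rk|kr] := ltnP r (2 ^ k); last first.
  rewrite (_ : cylinder k r = set0)//; apply/seteqP; split=> x //= xr.
  by have := res_lt k x; rewrite xr ltnNge kr.
by apply: sub_gen_smallest; right; exists k, r.
Qed.

Lemma measurable_to_odometer d (T : measurableType d) (h : T -> odometer) :
  (forall k r, (r < 2 ^ k)%N -> measurable (h @^-1` cylinder k r)) ->
  measurable_fun [set: T] h.
Proof.
move=> mh; apply: (@measurability _ _ T odometer _ _ cylinders) => //.
move=> _ [_ [->|[k [r [rk ->]]]] <-]; first by rewrite preimage_set0 setI0.
by rewrite setTI; exact: mh.
Qed.

Lemma preimage_rot_cylinder m k r : (r < 2 ^ k)%N ->
  rot m @^-1` cylinder k r = cylinder k (wrap k (r%:Z - m)).
Proof.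
by move=> rk; apply/seteqP; split=> x /= /eqP H; apply/eqP; move: H;
  rewrite res_rot_eq.
Qed.

Lemma measurable_rot m : measurable_fun [set: odometer] (rot m).
Proof.
apply: measurable_to_odometer => k r rk.
by rewrite preimage_rot_cylinder//; exact: measurable_cylinder.
Qed.

HB.instance Definition _ m := isMeasurableFun.Build _ _ odometer odometer (rot m)
  (measurable_rot m).

(** Cylinders together with the empty set are closed under intersection, so a
    finite measure on the odometer is determined by its values on them. *)
Lemma measure_unique_cylinder (R : realType)
    (m1 m2 : {measure set odometer -> \bar R}) :
  (m1 setT < +oo)%E ->
  (forall k r, (r < 2 ^ k)%N -> m1 (cylinder k r) = m2 (cylinder k r)) ->
  forall A : set odometer, measurable A -> m1 A = m2 A.
Proof.
move=> m1oo m12 A mA.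
have c0 : cylinder 0 0 = setT by apply/seteqP; split.
apply: (@measure_unique _ R odometer cylinders (fun=> cylinder 0 0) _ _ _ _
  m1 m2) => //.
- exact: setI_closed_cylinders.
- by move=> _; right; exists 0%N, 0%N.
- by rewrite bigcup_const// c0.
- by move=> _ [->|[k [r [rk ->]]]]; [rewrite !measure0|exact: m12].
- by move=> _; rewrite c0.
Qed.

(** * Normalised Haar measure, from binary digits of a uniform real *)

Section haar_measure.
Variable R : realType.

Definition unit_lebesgue := mrestr (@lebesgue_measure R) (measurable_itv `[0%R, 1%R[).

HB.instance Definition _ := Measure.on unit_lebesgue.

Lemma unit_lebesgue_setT : unit_lebesgue setT = 1%E.
Proof.
by rewrite /unit_lebesgue /mrestr setTI lebesgue_measure_itv/= lte_fin ltr01 oppr0 adde0.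
Qed.

HB.instance Definition _ := Measure_isProbability.Build _ _ _ unit_lebesgue
  unit_lebesgue_setT.

(** Digit i is 1 when the integer part of 2^(i+1) w is odd; this form makes each
    digit set a countable union of intervals. *)
Definition digits (w : measurableTypeR R) : odometer := fun i =>
  `[< exists n : nat, (2 * n + 1)%:R <= 2 ^+ i.+1 * w < (2 * n + 2)%:R >].

Lemma measurable_dyadic k (a b : R) :
  measurable [set w : measurableTypeR R | a <= 2 ^+ k * w < b].
Proof.
have k0 : 0 < 2 ^+ k :> R by rewrite exprn_gt0.
rewrite (_ : [set _ | _] = `[a / 2 ^+ k, b / 2 ^+ k[%classic).
  exact: measurable_itv.
by apply/seteqP; split=> w /=; rewrite in_itv/= ler_pdivrMr// ltr_pdivlMr// mulrC.
Qed.

(** Fixing the first k binary digits of w confines w to a dyadic interval of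
    length 2^-k.  The index N is the bit reversal of r, since digits of w start
    from the most significant one and residues from the least. *)
Lemma digits_cylinder k r : (r < 2 ^ k)%N -> exists2 N : nat, (N < 2 ^ k)%N &
  forall w : R, 0 <= w < 1 ->
    res k (digits w) = r <-> N%:R <= 2 ^+ k * w < (N + 1)%:R.
Proof.
elim: k r => [|k IH] r rk.
  exists 0%N => // w w01; rewrite /= expr0 mul1r add0n w01; split=> // _.
  by move: rk; rewrite expn0 ltnS leqn0 => /eqP.
have [|N Nk HN] := IH (r %% 2 ^ k)%N; first by rewrite ltn_mod expn_gt0.
have q2 : (r %/ 2 ^ k < 2)%N by rewrite ltn_divLR ?expn_gt0// -expnS.
exists (2 * N + r %/ 2 ^ k)%N; first by rewrite expnS; lia.
move=> w w01.
have -> : res k.+1 (digits w) = r <->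
    res k (digits w) = (r %% 2 ^ k)%N /\ digits w k = odd (r %/ 2 ^ k) :> bool.
  split=> [<-|[rE dE]]; first by rewrite -bit_res res_mod.
  rewrite [RHS](divn_eq r (2 ^ k)) -rE addnC /= dE.
  by move: (r %/ 2 ^ k)%N q2 => [|[|]].
rewrite HN// exprS -mulrA; set y := 2 ^+ k * w.
have -> : digits w k = `[< exists n : nat, (2 * n + 1)%:R <= 2 * y < (2 * n + 2)%:R >].
  by rewrite /digits exprS -mulrA.
have E a c : (2 * a + c)%:R = 2 * a%:R + c%:R :> R by rewrite natrD natrM.
have E1 a : (a + 1)%:R = a%:R + 1 :> R by rewrite natrD.
have key n : N%:R <= y < (N + 1)%:R -> (2 * n + 1)%:R <= 2 * y < (2 * n + 2)%:R ->
    n = N.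
  rewrite !E1 !E => /andP[a b] /andP[c e].
  by apply/eqP; rewrite eqn_leq -ltnS -(ltnS N) -!(ltr_nat R) -!natr1;
    apply/andP; split; lra.
have [q0|q1] : (r %/ 2 ^ k = 0 \/ r %/ 2 ^ k = 1)%N.
  by move: (r %/ 2 ^ k)%N q2 => [|[|]]//; [left|right].
(* The next digit selects the left (0) or right (1) half of the interval. *)
- rewrite q0 addn0 E E1 natrM; split=> [[Ny /asboolPn nd]|/andP[a b]].
    have [h|h] := ltP (2 * y) (2 * N%:R + 1).
      by rewrite andbT; move: Ny => /andP[]; lra.
    exfalso; apply: nd; exists N; rewrite !E h/=.
    by move: Ny => /andP[]; lra.
  have Ny : N%:R <= y < N%:R + 1 by apply/andP; split; lra.
  split=> //; apply/asboolPn => -[n ny]; have nN : n = N.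
    by apply: key => //; rewrite E1.
  by move: ny; rewrite nN !E => /andP[]; lra.
- rewrite q1 -addnA !E E1; split=> [[Ny /asboolP[n ny]]|/andP[a b]].
    have nN : n = N by apply: key => //; rewrite E1.
    by move: ny; rewrite nN !E.
  split; first by apply/andP; split; lra.
  by apply/asboolP; exists N; rewrite !E; apply/andP; split; lra.
Qed.

Lemma measurable_digits : measurable_fun setT digits.
Proof.
apply: measurable_to_odometer => k r _.
have mbit i b : measurable [set w | digits w i = b].
  have mT : measurable [set w | digits w i].
    rewrite (_ : [set _ | _] = \bigcup_n [set w : measurableTypeR R |
      (2 * n + 1)%:R <= 2 ^+ i.+1 * w < (2 * n + 2)%:R]); last first.
      by apply/seteqP; split=> [w /= /asboolP[n ?]|w [n _ /= ?]];
        [exists n|apply/asboolP; exists n].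
    by apply: bigcup_measurable => n _; exact: measurable_dyadic.
  case: b => //; rewrite (_ : [set _ | _] = ~` [set w | digits w i]); last first.
    by apply/seteqP; split=> w /=; case: (digits w i).
  exact: measurableC.
elim: k r => [|k IH] r.
  have [->|r0] := eqVneq r 0%N.
    by rewrite (_ : _ @^-1` _ = setT)//; apply/seteqP; split.
  rewrite (_ : _ @^-1` _ = set0)//; apply/seteqP; split=> w //= /esym/eqP.
  by rewrite (negbTE r0).
rewrite (_ : _ @^-1` _ = (digits @^-1` cylinder k r `&` [set w | digits w k = false])
   `|` (digits @^-1` cylinder k (r - 2 ^ k) `&`
     [set w | digits w k = true /\ (2 ^ k <= r)%N])); last first.
  rewrite /cylinder; apply/seteqP; split=> w /=.
    by case: (digits w k) => <-; rewrite ?mul1n ?mul0n ?addn0; [right|left];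
      rewrite ?addnK ?leq_addl.
  by move=> [[<- ->]|[-> [-> le]]]; rewrite ?mul1n ?mul0n ?addn0 ?subnK.
apply: measurableU; apply: measurableI => //.
have [le|lt] := leqP (2 ^ k) r.
  by rewrite (_ : [set _ | _] = [set w | digits w k = true])//; apply/seteqP;
    split=> w /= [].
by rewrite (_ : [set _ | _] = set0)//; apply/seteqP; split=> w /= [].
Qed.

HB.instance Definition _ := isMeasurableFun.Build _ _ _ _ digits measurable_digits.

Definition haar : probability odometer R := distribution unit_lebesgue digits.

Lemma haar_cylinder k r : (r < 2 ^ k)%N -> haar (cylinder k r) = (2 ^- k)%:E.
Proof.
move=> rk; have [N Nk HN] := digits_cylinder rk.
have k0 : 0 < 2 ^+ k :> R by rewrite exprn_gt0.
rewrite /haar /distribution /pushforward /= /unit_lebesgue /mrestr.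
rewrite (_ : _ `&` _ = `[N%:R / 2 ^+ k, (N + 1)%:R / 2 ^+ k[%classic); last first.
  apply/seteqP; split=> w /=; rewrite !in_itv/= ler_pdivrMr// ltr_pdivlMr// mulrC.
    by move=> [h w01]; apply/HN.
  move=> Nw; suff w01 : 0 <= w < 1 by split=> //; apply/HN.
  move: Nw => /andP[a b]; apply/andP; split.
    by rewrite -(pmulr_rge0 _ k0) (le_trans _ a).
  rewrite -(ltr_pM2l k0) mulr1 (lt_le_trans b)//.
  by rewrite -natrX ler_nat addn1.
rewrite lebesgue_measure_itv/= lte_fin ltr_pM2r ?invr_gt0// ltr_nat addn1 ltnSn.
by rewrite -EFinB -mulrBl -natr1 addrAC subrr add0r mul1r.
Qed.

(** The rotation permutes the cylinders of each level, which all have the same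
    measure. *)
Lemma haar_rot m (A : set odometer) : measurable A -> haar (rot m @^-1` A) = haar A.
Proof.
move=> mA; change (distribution haar (rot m) A = haar A).
apply: measure_unique_cylinder mA => [|k r rk].
  by apply: le_lt_trans (ltry 1); exact: (probability_le1 haar measurableT).
rewrite -[LHS]/(haar (rot m @^-1` cylinder k r)) preimage_rot_cylinder//.
rewrite (haar_cylinder (wrap_lt _ _)); exact/esym/haar_cylinder.
Qed.

End haar_measure.

(** * Blocks of an arbitrary process *)

Section blocks.
Variables (R : realType) (d : measure_display) (T : measurableType d).
Variables (P : probability T R) (X : int -> {RV P >-> bool}).

Lemma measurable_symbol m b : measurable [set w | X m w = b].
Proof.
rewrite -[[set w | _]]setTI.
by apply: (measurable_funPT (X m) _ [set b]).
Qed.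

Lemma block_isP m n (s : n.-tuple bool) w :
  block_is X m s w <-> forall i : 'I_n, X (m + i%:Z) w = tnth s i.
Proof.
split=> [<- i|H]; first by rewrite tnth_mktuple.
by apply: eq_from_tnth => i; rewrite tnth_mktuple.
Qed.

Lemma measurable_block_is m n (s : n.-tuple bool) : measurable (block_is X m s).
Proof.
rewrite (_ : block_is X m s =
    \big[setI/setT]_(i < n) [set w | X (m + i%:Z) w = tnth s i]).
  by apply: bigsetI_measurable => i _; exact: measurable_symbol.
rewrite -bigcap_seq; apply/seteqP; split=> w /=.
  by move=> <- i _ /=; rewrite tnth_mktuple.
move=> H; apply: eq_from_tnth => i; rewrite tnth_mktuple; apply: H => /=.
by rewrite mem_index_enum.
Qed.

Lemma block_bigcup m n (Q : set (n.-tuple bool)) :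
  [set w | Q (block X m n w)] = \bigcup_(s in Q) block_is X m s.
Proof.
apply/seteqP; split=> w /=; first by exists (block X m n w).
by move=> [s Qs sw]; rewrite (sw : _ = s).
Qed.

Lemma measurable_block m n (Q : set (n.-tuple bool)) :
  measurable [set w | Q (block X m n w)].
Proof.
rewrite block_bigcup; apply: fin_bigcup_measurable => // s _.
exact: measurable_block_is.
Qed.

Lemma block_is_cat m i j (y : i.-tuple bool) (x : j.-tuple bool) :
  block_is X m (cat_tuple y x) = block_is X m y `&` block_is X (m + i%:Z) x.
Proof.
apply/seteqP; split=> w.
  move=> /block_isP H; split; apply/block_isP => k.
    by rewrite -(tnth_lshift y x) -H.
  by rewrite -(tnth_rshift y x) -H /= PoszD addrA.
move=> [/block_isP Hy /block_isP Hx]; apply/block_isP => k.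
rewrite -(fintype.splitK k); case: (fintype.split k) => l /=.
  by rewrite tnth_lshift -Hy.
by rewrite tnth_rshift -Hx /= PoszD addrA.
Qed.

(** The block events [block_is X m y] are disjoint, so a proportionality that
    holds on each of them holds on any union of them. *)
Lemma proportional_block m n (Q : set (n.-tuple bool)) (A B : set T) (c : R) :
  measurable A -> measurable B -> 0 <= c ->
  (forall y, Q y -> P (block_is X m y `&` A) = (c%:E * P (block_is X m y `&` B))%E) ->
  P ([set w | Q (block X m n w)] `&` A) =
    (c%:E * P ([set w | Q (block X m n w)] `&` B))%E.
Proof.
move=> mA mB c0 H; rewrite !block_bigcup !setI_bigcupl.
have tr C : trivIset Q (fun y => block_is X m y `&` C).
  by move=> y z _ _ [w [[<- _] [<- _]]].
have mI C y : measurable C -> measurable (block_is X m y `&` C).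
  by move=> mC; apply: measurableI => //; exact: measurable_block_is.
have finQ : finite_set Q by exact: finite_finset.
rewrite !measure_fin_bigcup//; try (by move=> y _; exact: mI).
rewrite ge0_mule_fsumr//.
by apply: eq_fsbigr => y /set_mem; exact: H.
Qed.

End blocks.

(** * Factors of the odometer are stationary and ergodic *)

Section factor_process.
Variable R : realType.
Implicit Types f : {mfun odometer >-> bool}.

Definition factor f (m : int) : {RV (haar R) >-> bool} := f \o rot m.

Lemma block_factor_rot f k m n w :
  block (factor f) m n (rot k w) = block (factor f) (m + k) n w.
Proof.
apply: eq_from_tnth => i; rewrite !tnth_mktuple /= rotD.
by rewrite addrAC.
Qed.

Lemma stationary_factor f : stationary (factor f).
Proof.
move=> m n s; rewrite -[RHS](haar_rot R 1 (measurable_block_is _ _ _)).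
congr (haar R _); apply/seteqP; split=> w /=;
  by rewrite /block_is/= block_factor_rot.
Qed.

Lemma measurable_path_preimage f (A : set bipath) : measurable_path A ->
  measurable [set w | A (fun m => factor f m w)].
Proof.
move=> mA.
have mF := @measurability _ _ odometer (g_sigma_algebraType
  [set [set x : bipath | x m = b] | m in [set: int] & b in [set: bool]])
  setT (fun w m => factor f m w) _ erefl.
rewrite -[[set w | _]]setTI; apply: mF => //.
move=> _ [_ [m _ [b _ <-]] <-]; rewrite setTI.
exact: measurable_symbol.
Qed.

(** The rotation carries the parts of an invariant set D in the 2^k cylinders of
    level k onto each other, so D meets all of them equally: D is independent of
    every cylinder. *)
Lemma invariant_cylinder (D : set odometer) k r : (r < 2 ^ k)%N ->
  measurable D -> rot 1 @^-1` D = D ->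
  haar R (D `&` cylinder k r) = (haar R D * haar R (cylinder k r))%E.
Proof.
move=> rk mD D1.
have Drot (i : nat) : rot i%:Z @^-1` D = D.
  elim: i => [|i IH].
    apply/seteqP; split=> x /=; rewrite (_ : rot 0 x = x)//; apply: eq_from_res => j;
      by rewrite res_rot addr0 wrap_nat modn_small// res_lt.
  by rewrite -[RHS]D1 -[in RHS]IH; apply/seteqP; split=> x /=; rewrite rotD intS addrC.
have mDC i : measurable (D `&` cylinder k i).
  by apply: measurableI => //; exact: measurable_cylinder.
have same i : (i < 2 ^ k)%N ->
    haar R (D `&` cylinder k i) = haar R (D `&` cylinder k 0).
  move=> ik; rewrite -(haar_rot R i%:Z (mDC i)) preimage_setI Drot.
  by rewrite preimage_rot_cylinder// subrr wrap_nat mod0n.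
have sumD : haar R D = (\sum_(i < 2 ^ k) haar R (D `&` cylinder k i))%E.
  rewrite -measure_bigsetU_ord//; last first.
    apply/trivIsetP => i j _ _ ij; apply/seteqP; split=> x //= [[_ xi] [_ xj]].
    by move/eqP: ij; apply; exact/ord_inj/(etrans (esym xi) xj).
  congr (haar R _); rewrite -(bigcup_mkord _ (fun i => D `&` cylinder k i)).
  apply/seteqP; split=> x.
    by move=> Dx; exists (res k x) => //=; exact: res_lt.
  by move=> [i _ []].
rewrite same// sumD.
under eq_bigr => i _ do rewrite same ?ltn_ord//.
have fin := fin_num_measure (haar R) _ (mDC 0%N).
rewrite haar_cylinder// -(fineK fin) sumEFin -EFinM sumr_const card_ord.
by congr (_%:E); rewrite -(mulr_natr (fine _)) -mulrA natrX mulfV ?mulr1// expf_neq0.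
Qed.

(** An invariant event is independent of all cylinders, hence of itself, and so
    has probability 0 or 1. *)
Lemma ergodic_factor f : ergodic (factor f).
Proof.
move=> A mA invA; set D := [set w | _].
have mD : measurable D by exact: measurable_path_preimage.
have D1 : rot 1 @^-1` D = D.
  rewrite [RHS](_ : _ = [set w | (time_shift @^-1` A) (fun m => factor f m w)]).
    apply/funext => w; congr A; apply/funext => m.
    by rewrite /time_shift /= rotD.
  by rewrite invA.
(* Both sides, with one copy of D replaced by a variable set, are measures
   that agree on cylinders. *)
have self : haar R D = (haar R D * haar R D)%E.
  pose c : {nonneg R} := NngNum (fine_ge0 (measure_ge0 (haar R) D)).
  have cE : c%:num%:E = haar R D by rewrite fineK// fin_num_measure.
  rewrite -{1}(setIid D) -{1}cE.
  apply: (@measure_unique_cylinder R (mrestr (haar R) mD)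
    (mscale c (haar R)) _ _ D mD) => [|k r rk].
    by apply: le_lt_trans (ltry 1); apply: probability_le1; exact: measurableI.
  change (haar R (cylinder k r `&` D) = c%:num%:E * haar R (cylinder k r))%E.
  by rewrite setIC cE; exact: invariant_cylinder.
move: self; have fin := fin_num_measure (haar R) _ mD.
rewrite -(fineK fin) -EFinM => -[e].
have /eqP : fine (haar R D) * (1 - fine (haar R D)) = 0 by rewrite mulrBr mulr1 -e subrr.
rewrite mulf_eq0 subr_eq0 => /orP[/eqP ->|/eqP <-]; [by left|by right].
Qed.

End factor_process.

(** * Distance between factors, and periodic factors *)

Section factor_distance.
Variable R : realType.
Implicit Types f g h : {mfun odometer >-> bool}.
Local Notation pr A := (fine (haar R A)).

Lemma EFin_pr (A : set odometer) : measurable A -> (pr A)%:E = haar R A.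
Proof. by move=> mA; rewrite fineK// fin_num_measure. Qed.

Lemma pr_ge0 (A : set odometer) : 0 <= pr A.
Proof. exact/fine_ge0/measure_ge0. Qed.

Lemma le_pr (A B : set odometer) : measurable A -> measurable B -> A `<=` B ->
  pr A <= pr B.
Proof.
move=> mA mB AB; rewrite -lee_fin !EFin_pr//.
by apply: le_measure; rewrite ?inE.
Qed.

Lemma pr_subU (A B C : set odometer) : measurable A -> measurable B -> measurable C ->
  A `<=` B `|` C -> pr A <= pr B + pr C.
Proof.
move=> mA mB mC ABC; rewrite -lee_fin EFinD !EFin_pr//.
apply: (@le_trans _ _ (haar R (B `|` C))).
  by apply: le_measure; rewrite ?inE//; exact: measurableU.
exact: measureU2.
Qed.

Definition fdist f g : R := pr [set x | f x != g x].

Lemma measurable_neq f g : measurable [set x | f x != g x].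
Proof.
have mb h b : measurable [set w | h w = b].
  by rewrite -[[set w | _]]setTI; apply: (measurable_funPT h _ [set b]).
rewrite (_ : [set x | _] = ([set x | f x = true] `&` [set x | g x = false]) `|`
    ([set x | f x = false] `&` [set x | g x = true])).
  by apply: measurableU; apply: measurableI; exact: mb.
apply/seteqP; split=> x /=; first by case: (f x); case: (g x); [|left|right|].
by move=> [[-> ->]|[-> ->]].
Qed.

Lemma fdistxx f : fdist f f = 0.
Proof.
rewrite /fdist (_ : [set x | _] = set0) ?measure0//.
by apply/seteqP; split=> x //=; rewrite eqxx.
Qed.

Lemma fdistC f g : fdist f g = fdist g f.
Proof.
by rewrite /fdist; congr (pr _); apply/seteqP; split=> x /=; rewrite eq_sym.
Qed.

Lemma fdist_triangle f g h : fdist f h <= fdist f g + fdist g h.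
Proof.
apply: pr_subU; try exact: measurable_neq.
by move=> x /=; have [->|ne] := eqVneq (f x) (g x); [right|left].
Qed.

Lemma pr_neq_rot f g m : pr [set x | f (rot m x) != g (rot m x)] = fdist f g.
Proof. by congr fine; rewrite -[RHS](haar_rot R m (measurable_neq f g)). Qed.

Lemma measurable_neq_rot f g m : measurable [set x | f (rot m x) != g (rot m x)].
Proof.
exact: (measurable_neq (factor R f m) (factor R g m)).
Qed.

(** A block of length n reads f at n points of the orbit, each of which falls in
    the set where f and g differ with probability [fdist f g]. *)
Lemma pr_block_close f g m n (Q : set (n.-tuple bool)) :
  pr [set w | Q (block (factor R f) m n w)] <=
  pr [set w | Q (block (factor R g) m n w)] + n%:R * fdist f g.
Proof.
pose N (i : nat) := [set x | f (rot (m + i%:Z) x) != g (rot (m + i%:Z) x)].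
have mN i : measurable (N i) by exact: measurable_neq_rot.
have mU : measurable (\big[setU/set0]_(i < n) N i) by exact: bigsetU_measurable.
apply: (@le_trans _ _ (pr [set w | Q (block (factor R g) m n w)] +
    pr (\big[setU/set0]_(i < n) N i))).
  apply: pr_subU => //; try exact: measurable_block.
  move=> w /= Qw; have [e|ne] := eqVneq (block (factor R g) m n w)
    (block (factor R f) m n w); first by left; rewrite e.
  right; rewrite -bigcup_mkord; apply: contrapT => H; move/eqP: ne; apply.
  apply: eq_from_tnth => i; rewrite !tnth_mktuple /=.
  apply/eqP; rewrite eq_sym; apply/negPn/negP => Ni; apply: H.
  by exists i => //=.
rewrite lerD2l -lee_fin EFin_pr//.
apply: (le_trans (Boole_inequality _ (fun i _ => mN i))).
rewrite (eq_bigr (fun=> (fdist f g)%:E)); last first.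
  by move=> i _; rewrite -(pr_neq_rot f g (m + i%:Z)) EFin_pr//; exact: mN.
by rewrite sumEFin sumr_const card_ord lee_fin (mulr_natl (fdist f g)).
Qed.

Definition periodic k f := forall x y, res k x = res k y -> f x = f y.

Definition is_periodic f := exists k, periodic k f.

Lemma periodic_le j k f : (j <= k)%N -> periodic j f -> periodic k f.
Proof. by move=> jk pf x y xy; apply: pf; rewrite -(res_mod x jk) xy res_mod. Qed.

Lemma periodic_shift k f m w : periodic k f ->
  f (rot (m - (2 ^ k)%N%:Z) w) = f (rot m w).
Proof.
move=> pf; apply: pf; rewrite !res_rot addrA /wrap.
by rewrite -{2}(subrK (2 ^ k)%N%:Z ((res k w)%:Z + m)) modzDr.
Qed.

(** A past of one full period determines the next symbol: it repeats the oldest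
    symbol of that past. *)
Lemma periodic_markov f : is_periodic f -> finite_order_markov (factor R f).
Proof.
move=> [k pf]; exists (2 ^ k)%N => n i y x b E F FE0.
pose x0 := tnth x (Ordinal (expn_gt0 2 k : (0 < 2 ^ k)%N)).
have Xn w : E w -> factor R f n w = x0.
  move=> /block_isP/(_ (Ordinal (expn_gt0 2 k : (0 < 2 ^ k)%N))) /=.
  by rewrite addr0 periodic_shift.
have mE : measurable E by exact: measurable_block_is.
have mF : measurable F by exact: measurable_block_is.
have cond S : measurable S -> (0 < haar R S)%E -> S `<=` E ->
    condP (haar R) [set w | factor R f n w = b] S = (b == x0)%:R.
  move=> mS S0 SE; rewrite /condP; have [bx|bx] := eqVneq b x0.
    rewrite (_ : _ `&` _ = S) ?divff//; last first.
      by apply/seteqP; split=> [w []|w Sw]//; split=> //=; rewrite bx; apply/Xn/SE.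
    by rewrite gt_eqF// -lte_fin EFin_pr.
  rewrite (_ : _ `&` _ = set0) ?measure0 ?mul0r//.
  apply/seteqP; split=> // w [/= wb Sw]; move/eqP: bx; apply.
  by rewrite -wb; apply/Xn/SE.
have mFE : measurable (F `&` E) by exact: measurableI.
have E0 : (0 < haar R E)%E.
  by apply: (lt_le_trans FE0); apply: le_measure; rewrite ?inE.
by rewrite (cond E)// (cond (F `&` E))//; exact: subIsetr.
Qed.

End factor_distance.

(** * Rigid processes of full support are not finitarily Markovian *)

Section rigidity.
Variable R : realType.
Implicit Types f g h : {mfun odometer >-> bool}.
Local Notation pr A := (fine (haar R A)).

Definition periodic_limit f :=
  forall e : R, 0 < e -> exists g, is_periodic g /\ fdist R f g < e.

Definition full_support f :=
  forall n (s : n.-tuple bool), (0 < haar R (block_is (factor R f) 0 s))%E.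

Lemma block_is_rot f m n (s : n.-tuple bool) :
  haar R (block_is (factor R f) m s) = haar R (block_is (factor R f) 0 s).
Proof.
rewrite -[RHS](haar_rot R m (measurable_block_is _ _ _)).
congr (haar R _); apply/seteqP; split=> w /=;
  by rewrite /block_is/= block_factor_rot add0r.
Qed.

(** Close to f there is some g with g (x - 2^k) = g x, and the rotation preserves
    the measure, so f (x - 2^k) differs from f x only on a small set. *)
Lemma periodic_limit_rigid f K (e : R) : periodic_limit f -> 0 < e ->
  exists2 k, (K < 2 ^ k)%N &
    pr [set w | f (rot 0 w) != f (rot (- (2 ^ k)%N%:Z) w)] <= e.
Proof.
move=> lf e0; have [|g [[j pg] fg]] := lf (e / 2); first by rewrite divr_gt0.
exists (maxn j K); first by rewrite (leq_ltn_trans (leq_maxr j K))// ltn_expl.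
set k := maxn j K; have pk : periodic k g by apply: periodic_le pg; exact: leq_maxl.
set N0 := [set x | f (rot 0 x) != g (rot 0 x)].
set N1 := [set x | f (rot (- (2 ^ k)%N%:Z) x) != g (rot (- (2 ^ k)%N%:Z) x)].
apply: (@le_trans _ _ (pr N0 + pr N1)).
  apply: pr_subU; try exact: measurable_neq_rot.
    exact: (measurable_neq (factor R f 0) (factor R f (- (2 ^ k)%N%:Z))).
  move=> w /= ne; rewrite /N0 /N1 /=; apply/orP; rewrite -negb_and.
  apply: contra ne => /andP[/eqP -> /eqP ->].
  by rewrite -(periodic_shift 0 w pk) sub0r.
by rewrite /N0 /N1 !pr_neq_rot; lra.
Qed.

(** Suppose that K symbols of past, with event E, satisfy the defining condition
    at a sample point, and let p = P(X_0 = 1 | E).  By full support no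
    conditional probability vanishes, so p is also the conditional probability
    given every longer past; summing over pasts of length 2^k with oldest symbol
    0 (event C) gives P(C, X_0 = 1, E) = p P(C, E).  By rigidity the left side
    is small while P(C, E) is at least about P(X_0 = 0, E) > 0. *)
Lemma rigid_not_finitarily_markovian f :
  periodic_limit f -> full_support f -> ~ finitarily_markovian (factor R f).
Proof.
move=> lf ff fm.
have [w [K HK]] : exists w : odometer, exists K : nat,
    forall (i : nat) (y : i.-tuple bool), (0 < i)%N ->
      let E := block_is (factor R f) (- K%:Z) (block (factor R f) (- K%:Z) K w) in
      let F := block_is (factor R f) (- (K + i)%N%:Z) y in
      (0 < haar R (F `&` E))%E ->
      0 < condP (haar R) [set v | factor R f 0 v = true] (F `&` E) ->
      condP (haar R) [set v | factor R f 0 v = true] E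
        = condP (haar R) [set v | factor R f 0 v = true] (F `&` E).
  apply: contrapT => nw; case: fm => A [mA A0 subA].
  have : haar R setT = 0%E.
    apply/eqP; rewrite -measure_le0 -A0; apply: le_measure; rewrite ?inE//.
    by move=> w _; apply: subA => /= Hw; apply: nw; exists w.
  by rewrite probability_setT => /eqP; rewrite onee_eq0.
move: HK; set x := block _ _ _ w; set E := block_is _ _ x.
set G := [set v | factor R f 0 v = true].
set H := [set v | factor R f 0 v = false].
move=> HK; cbv zeta in HK.
have mE : measurable E by exact: measurable_block_is.
have mG : measurable G by exact: measurable_symbol.
have mH : measurable H by exact: measurable_symbol.
have posB m n (s : n.-tuple bool) : (0 < haar R (block_is (factor R f) m s))%E.
  by rewrite block_is_rot; exact: ff.
have next b : [set v | factor R f 0 v = b] = block_is (factor R f) 0 [tuple b].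
  apply/seteqP; split=> v.
    by move=> vb; apply/block_isP => i; rewrite ord1.
  by move=> /block_isP/(_ ord0) /=; rewrite addr0.
have posEb b : (0 < haar R (E `&` [set v | factor R f 0 v = b]))%E.
  have := posB (- K%:Z) _ (cat_tuple x [tuple b]).
  by rewrite block_is_cat addNr next.
have posFE i (y : i.-tuple bool) : (0 < haar R (block_is (factor R f) (- (K + i)%N%:Z) y `&` E))%E.
  have := posB (- (K + i)%N%:Z) _ (cat_tuple y x).
  by rewrite block_is_cat PoszD opprD addrNK.
have posFEG i (y : i.-tuple bool) :
    (0 < haar R (G `&` (block_is (factor R f) (- (K + i)%N%:Z) y `&` E)))%E.
  have := posB (- (K + i)%N%:Z) _ (cat_tuple (cat_tuple y x) [tuple true]).
  rewrite !block_is_cat (PoszD i) addrA PoszD opprD addrNK addNr setIC.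
  by rewrite /G next.
have fineP A : measurable A -> (0 < haar R A)%E -> 0 < pr A.
  by move=> mA A0; rewrite -lte_fin EFin_pr.
set p := condP (haar R) G E.
have E0 : 0 < pr E by apply: fineP => //; exact: posB.
have p0 : 0 < p.
  rewrite divr_gt0//; apply: fineP; first exact: measurableI.
  by rewrite setIC; exact: posEb.
have p1 : p <= 1.
  by rewrite ler_pdivrMr// mul1r; apply: le_pr => //; exact: measurableI.
have q0 : 0 < pr (E `&` H) by apply: fineP; [exact: measurableI|exact: posEb].
(* With q = P(E, X_0 = 0), the estimates below give p q <= (1 + p) P(D) <= 2 P(D),
   so P(D) <= p q / 4 is contradictory. *)
have [|k Kk rig] := periodic_limit_rigid K (e := p * pr (E `&` H) / 4) lf.
  by rewrite divr_gt0// mulr_gt0.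
set D := [set v | _] in rig.
(* The oldest symbol of a past of length K + i = 2^k is X_{-2^k}. *)
pose i := (2 ^ k - K)%N; have i0 : (0 < i)%N by rewrite subn_gt0.
have Ki : (K + i = 2 ^ k)%N by rewrite subnKC// ltnW.
pose Q : set (i.-tuple bool) := [set y | tnth y (Ordinal i0) = false].
pose C := [set v | Q (block (factor R f) (- (K + i)%N%:Z) i v)].
have mC : measurable C by exact: measurable_block.
have CE v : C v <-> f (rot (- (2 ^ k)%N%:Z) v) = false.
  by rewrite /C /Q /= tnth_mktuple /= addr0 Ki.
(* The finitarily Markovian condition, summed over the longer pasts in C. *)
have CGE : haar R (C `&` (G `&` E)) = (p%:E * haar R (C `&` E))%E.
  apply: proportional_block => //; [exact: measurableI|exact: ltW|move=> y _].
  have mFE : measurable (block_is (factor R f) (- (K + i)%N%:Z) y `&` E).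
    by apply: measurableI => //; exact: measurable_block_is.
  have mGFE := measurableI _ _ mG mFE.
  have FE0 := fineP _ mFE (posFE i y).
  have := HK i y i0 (posFE i y).
  rewrite -/p {2}/condP => -> //; last by rewrite divr_gt0// fineP.
  rewrite setICA in mGFE *; apply: (etrans (esym (EFin_pr R mGFE))).
  apply: (etrans _ (congr1 (mule _) (EFin_pr R mFE))).
  by rewrite -EFinM divfK// gt_eqF.
have mD : measurable D.
  exact: (measurable_neq (factor R f 0) (factor R f (- (2 ^ k)%N%:Z))).
have mCE : measurable (C `&` E) by exact: measurableI.
have mCGE : measurable (C `&` (G `&` E)) by apply: measurableI => //; exact: measurableI.
have le1 : pr (C `&` (G `&` E)) <= pr D.
  apply: le_pr => // v [Cv [Gv _]]; rewrite /D /= ((CE v).1 Cv).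
  by rewrite (Gv : f (rot 0 v) = true).
have le2 : pr (E `&` H) <= pr (C `&` E) + pr D.
  apply: pr_subU => //; first exact: measurableI.
  move=> v [Ev Hv]; have [fv|fv] := boolP (f (rot (- (2 ^ k)%N%:Z) v)).
    by right; rewrite /D /= (Hv : f (rot 0 v) = false) fv.
  by left; split=> //; apply/(CE v).2/negbTE.
have e1 : pr (C `&` (G `&` E)) = p * pr (C `&` E).
  by apply: EFin_inj; rewrite EFinM !EFin_pr.
rewrite e1 in le1.
have le3 : p * pr (E `&` H) <= p * pr (C `&` E) + p * pr D.
  by rewrite -mulrDr ler_pM2l.
have le4 : p * pr D <= pr D by rewrite ler_piMl// pr_ge0.
have : 0 < p * pr (E `&` H) by rewrite mulr_gt0.
lra.
Qed.

End rigidity.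

(** * A Baire category argument *)

Section baire.
Variable R : realType.
Implicit Types f g h : {mfun odometer >-> bool}.
Local Notation pr A := (fine (haar R A)).

Lemma mfun_of_set (S : set odometer) : measurable S ->
  exists h, forall x, h x = `[< S x >].
Proof.
move=> mS; pose h (x : odometer) := `[< S x >].
have mh : measurable_fun setT h.
  apply: (measurable_fun_bool true); rewrite setTI.
  by rewrite (_ : _ @^-1` _ = S)//; apply/seteqP; split=> x /= /asboolP.
pose m := isMeasurableFun.Build _ _ _ _ h mh.
pose h' : {mfun odometer >-> bool} := HB.pack h m.
by exists h'.
Qed.

(** If f_j and f_{j+1} are close with geometrically decreasing errors, then
    f_j x is eventually constant for almost every x; off the union over i >= j
    of the sets where f_i and f_{i+1} differ, the limit equals f_j. *)
Lemma fdist_limit (f_ : nat -> {mfun odometer >-> bool}) (r_ : nat -> R) :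
  (forall i, 0 < r_ i) -> (forall i, r_ i.+1 <= r_ i / 2) ->
  (forall i, fdist R (f_ i) (f_ i.+1) <= r_ i / 4) ->
  exists h, forall j, fdist R (f_ j) h <= r_ j / 2.
Proof.
move=> r0 rS fS.
have mf i : measurable [set x | f_ i x].
  exact: (measurable_funPTI (f_ i) (Y := [set true])).
(* The inferior limit, which is measurable without any exceptional set. *)
pose S := \bigcup_N \bigcap_(j in [set j | (N <= j)%N]) [set x | f_ j x].
have mS : measurable S.
  apply: bigcup_measurable => N _; apply: bigcap_measurable => //.
  by exists N => /=.
have [h hE] := mfun_of_set mS; exists h => j.
pose N i := [set x | f_ (j + i)%N x != f_ (j + i).+1 x].
have mN i : measurable (N i) by exact: measurable_neq.
have sub : [set x | f_ j x != h x] `<=` \bigcup_i N i.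
  move=> x /= ne; apply: contrapT => nN.
  have st i : f_ (j + i)%N x = f_ j x.
    elim: i => [|i <-]; first by rewrite addn0.
    rewrite addnS; apply/esym/eqP/negPn/negP => ?; apply: nN; by exists i.
  move/eqP: ne; apply; rewrite hE; case fjx : (f_ j x); apply/esym.
    apply/asboolP; exists j => // i /= ji.
    by rewrite -(subnKC ji) st fjx.
  apply/asboolPn => -[M _ HM]; have /= := HM (j + M)%N (leq_addl _ _).
  by rewrite st fjx.
have rle i : r_ (j + i)%N <= r_ j / 2 ^+ i.
  elim: i => [|i IH]; first by rewrite addn0 expr0 divr1.
  rewrite addnS (le_trans (rS _))// exprSr invfM mulrA.
  by rewrite ler_pM2r// invr_gt0.
rewrite -lee_fin EFin_pr; last exact: measurable_neq.
apply: (le_trans (@measure_sigma_subadditive _ R odometer (haar R) _ _ mN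
  (measurable_neq _ _) sub)).
apply: (le_trans _ (@epsilon_trick0 R (r_ j / 2) xpredT _)); last first.
  by rewrite divr_ge0// ltW.
apply: lee_nneseries => // i _.
apply: (@le_trans _ _ (fdist R (f_ (j + i)%N) (f_ (j + i).+1))%:E).
  by rewrite EFin_pr//; exact: mN.
rewrite lee_fin (le_trans (fS _))//.
have -> : (2 ^ i.+1)%:R = 2 * 2 ^+ i :> R by rewrite natrX exprS.
rewrite (_ : r_ j / 2 / _ = (r_ j / 2 ^+ i) / 4) ?ler_pM2r//.
by rewrite !invfM; lra.
Qed.

(** Countably many open conditions, each of which can be met by a small periodic
    change of any periodic function, can be met together near any periodic
    function.  Openness carries the conditions over to the limit of the successive
    changes; density is asked for within the periodic functions only, so the
    approximants stay periodic and the limit is rigid. *)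
Lemma baire (I : countType) (U : I -> set {mfun odometer >-> bool}) :
  (forall i f, U i f -> exists2 e : R, 0 < e & forall g, fdist R f g < e -> U i g) ->
  (forall i f (e : R), is_periodic f -> 0 < e ->
    exists g, [/\ is_periodic g, fdist R f g < e & U i g]) ->
  forall f (e : R), is_periodic f -> 0 < e ->
    exists h, [/\ periodic_limit R h, fdist R f h < e & forall i, U i h].
Proof.
move=> openU denseU f e pf e0.
pose good (s : {mfun odometer >-> bool} * R) := is_periodic s.1 /\ 0 < s.2.
(* State: a periodic function and a radius.  Step n enters the open set number n
   by a move of at most a quarter of the radius, then at least halves the radius
   so that the new ball lies in that set; all later moves together amount to at
   most half of the new radius. *)
have step (ns : nat * ({mfun odometer >-> bool} * R)) :
    exists s : {mfun odometer >-> bool} * R, good ns.2 ->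
    [/\ good s, s.2 <= ns.2.2 / 2, fdist R ns.2.1 s.1 <= ns.2.2 / 4 &
      forall i, unpickle ns.1 = Some i -> forall h, fdist R s.1 h < s.2 -> U i h].
  case: ns => n [g r] /=.
  have [[pg r0]|] := pselect (good (g, r)); last by exists (g, r).
  case: (unpickle n) => [i|]; last first.
    exists (g, r / 2) => _; split=> //=; first by split => //; rewrite divr_gt0.
    by rewrite fdistxx divr_ge0 ?ltW.
  have [|h [ph gh Uh]] := denseU i g (r / 4) pg; first by rewrite divr_gt0.
  have [c c0 Hc] := openU i h Uh.
  exists (h, Num.min c (r / 2)) => _; split=> //=.
  - by split=> //=; rewrite lt_min c0 divr_gt0.
  - by rewrite ge_min lexx orbT.
  - exact: ltW.
  - by move=> _ [<-] h' hh'; apply: Hc; rewrite (lt_le_trans hh')// ge_min lexx.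
have [next Hnext] := choice step.
pose fix s (n : nat) := if n is n'.+1 then next (n', s n') else (f, e).
have goods n : good (s n).
  by elim: n => [|n IH] //=; have [] := Hnext (n, s n) IH.
have [h Hh] := @fdist_limit (fun n => (s n).1) (fun n => (s n).2)
  (fun n => (goods n).2)
  (fun n => let: And4 _ H _ _ := Hnext (n, s n) (goods n) in H)
  (fun n => let: And4 _ _ H _ := Hnext (n, s n) (goods n) in H).
exists h; split.
- have sle n : (s n).2 <= e / 2 ^+ n.
    elim: n => [|n IH]; first by rewrite expr0 divr1.
    have [_ H _ _] := Hnext (n, s n) (goods n).
    rewrite (le_trans H)// exprSr invfM mulrA ler_pM2r// invr_gt0//.
  move=> c c0; pose n := Num.truncn (e / c).
  exists (s n.+1).1; split; first exact: (goods _).1.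
  rewrite fdistC (le_lt_trans (Hh _))//.
  apply: (@lt_trans _ _ (s n.+1).2).
    by have := (goods n.+1).2; lra.
  apply: (le_lt_trans (sle _)); rewrite ltr_pdivrMr ?exprn_gt0//.
  rewrite -ltr_pdivrMl// mulrC; apply: (lt_trans (truncnS_gt _)).
  by rewrite -natrX ltr_nat ltn_expl.
- by rewrite (le_lt_trans (Hh 0%N))//=; lra.
- move=> i; have [_ _ _] := Hnext (pickle i, s (pickle i)) (goods _).
  move=> /(_ i (pickleK i)); apply.
  apply: (le_lt_trans (Hh (pickle i).+1)) => /=.
  have := (goods (pickle i).+1).2; rewrite /=; lra.
Qed.

End baire.

(** * Full support is generic *)

Section genericity.
Variable R : realType.
Implicit Types f g h : {mfun odometer >-> bool}.
Local Notation pr A := (fine (haar R A)).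

Lemma mfun_of_periodic k (u : odometer -> bool) :
  (forall x y, res k x = res k y -> u x = u y) -> exists g, forall x, g x = u x.
Proof.
move=> pu.
have mu : measurable [set x | u x].
  rewrite (_ : [set x | u x] = \bigcup_(r in [set res k x | x in [set x | u x]]) cylinder k r).
    by apply: bigcup_measurable => r _; exact: measurable_cylinder.
  apply/seteqP; split=> x /=; first by move=> ux; exists (res k x) => //=; exists x.
  by move=> [_ [y uy <-] xy]; rewrite /= (pu _ y).
by have [g gE] := mfun_of_set mu; exists g => x; rewrite gE asboolb.
Qed.

Lemma fdist_le_cylinders f g k n : (n <= 2 ^ k)%N ->
  (forall x, (n <= res k x)%N -> f x = g x) -> fdist R f g <= n%:R / 2 ^+ k.
Proof.
move=> nk fg.
have mC i : measurable (cylinder k i : set odometer) by exact: measurable_cylinder.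
apply: (@le_trans _ _ (pr (\big[setU/set0]_(i < n) (cylinder k i : set odometer)))).
  apply: le_pr; first exact: measurable_neq; first exact: bigsetU_measurable.
  move=> x /= ne; rewrite -(bigcup_mkord n (cylinder k)); exists (res k x) => //=.
  by rewrite ltnNge; apply: contra ne => /fg ->.
rewrite -lee_fin EFin_pr; last exact: bigsetU_measurable.
apply: (le_trans (@Boole_inequality _ R odometer (haar R) (cylinder k) n (fun i _ => mC i))).
rewrite (eq_bigr (fun=> (2 ^- k)%:E)).
  by rewrite sumEFin sumr_const card_ord lee_fin mulr_natl.
by move=> i _; apply: haar_cylinder; exact: leq_trans (ltn_ord i) nk.
Qed.

(** Overwrite n consecutive positions with s once in every 2^k: the change has
    density n / 2^k, and the word then occurs with probability at least 2^-k. *)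
Lemma insert_word f (e : R) n (s : n.-tuple bool) : is_periodic f -> 0 < e ->
  exists g, [/\ is_periodic g, fdist R f g < e &
    (0 < haar R (block_is (factor R g) 0 s))%E].
Proof.
move=> [j pf] e0; pose N := Num.truncn (n%:R / e); pose k := (j + n + N.+1)%N.
have nk : (n < 2 ^ k)%N by rewrite (leq_ltn_trans _ (ltn_expl k _))// /k; lia.
have pfk : periodic k f by apply: periodic_le pf; rewrite /k -addnA leq_addr.
have [|g gE] := @mfun_of_periodic k
  (fun x => if (res k x < n)%N then nth false s (res k x) else f x).
  by move=> x y xy; rewrite xy (pfk x y xy).
exists g; split.
- by exists k => x y xy; rewrite !gE xy (pfk x y xy).
- apply: (@le_lt_trans _ _ (n%:R / 2 ^+ k)).
    by apply: fdist_le_cylinders => [|x]; [exact: ltnW|rewrite gE ltnNge => ->].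
  rewrite ltr_pdivrMr ?exprn_gt0// -ltr_pdivrMl// mulrC.
  apply: (lt_trans (truncnS_gt _)); rewrite -natrX ltr_nat.
  by rewrite (leq_ltn_trans _ (ltn_expl k _))// /k -/N; lia.
- apply: (@lt_le_trans _ _ (haar R (cylinder k 0))).
    by rewrite haar_cylinder ?expn_gt0// lte_fin invr_gt0 exprn_gt0.
  apply: le_measure; rewrite ?inE; first exact: measurable_cylinder.
    exact: measurable_block_is.
  move=> w w0; apply/block_isP => i.
  rewrite /= gE res_rot (w0 : res k w = 0%N) !add0r wrap_nat modn_small.
    by rewrite ltn_ord (tnth_nth false).
  exact: ltn_trans (ltn_ord i) nk.
Qed.

Lemma open_block_gt m n (Q : set (n.-tuple bool)) f (c : R) :
  c < pr [set w | Q (block (factor R f) m n w)] ->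
  exists2 e : R, 0 < e & forall g, fdist R f g < e ->
    c < pr [set w | Q (block (factor R g) m n w)].
Proof.
set p := pr _ => cp; exists ((p - c) / n.+1%:R); first by rewrite divr_gt0// subr_gt0.
move=> g; rewrite ltr_pdivlMr// => fg.
have := pr_block_close R f g m Q; rewrite -/p.
have : fdist R f g * n%:R <= fdist R f g * n.+1%:R.
  by rewrite ler_wpM2l ?pr_ge0// ler_nat.
lra.
Qed.

Lemma full_support_dense f (e : R) : is_periodic f -> 0 < e ->
  exists h, [/\ periodic_limit R h, fdist R f h < e & full_support R h].
Proof.
move=> pf e0.
pose U (i : {n : nat & n.-tuple bool}) : set {mfun odometer >-> bool} :=
  [set g | (0 < haar R (block_is (factor R g) 0 (tagged i)))%E].
have openU i g : U i g ->
    exists2 c : R, 0 < c & forall h, fdist R g h < c -> U i h.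
  case: i => n s Us; have [|c c0 Hc] := @open_block_gt 0 n [set s] g 0.
    by rewrite -lte_fin EFin_pr//; exact: measurable_block_is.
  exists c => // h /Hc; rewrite -lte_fin EFin_pr//; exact: measurable_block_is.
have [|h [ph fh Uh]] := baire openU _ pf e0.
  by move=> [n s] g c pg c0; exact: insert_word.
by exists h; split=> // n s; exact: (Uh (Tagged _ s)).
Qed.

End genericity.

(** * Existence of a process with both upper limits equal to 1 *)

Lemma limn_esup_eq1 (R : realType) (u : nat -> \bar R) : (forall n, (u n <= 1)%E) ->
  (forall i, exists2 n, (i <= n)%N & ((1 - i.+1%:R^-1)%:E < u n)%E) ->
  limn_esup u = 1%E.
Proof.
move=> u1 Hu; rewrite limn_esup_lim (_ : esups u = cst 1%E) ?lim_cst//.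
apply/funext => n; apply/eqP; rewrite eq_le; apply/andP; split.
  by apply/ereal_supP => _ [m _ <-].
apply/lee_addgt0Pr => e e0.
pose i := maxn n (Num.truncn e^-1).
have [m im um] := Hu i; apply: (@le_trans _ _ (u m + e%:E)%E).
  apply: (@le_trans _ _ ((1 - i.+1%:R^-1)%:E + e%:E)%E); last by rewrite leeD2r// ltW.
  rewrite -EFinD lee_fin -addrA lerDl addrC subr_ge0.
  rewrite invf_ple ?posrE//; apply/ltW/(lt_le_trans (truncnS_gt _)).
  by rewrite ler_nat ltnS leq_maxr.
rewrite leeD2r//; apply: ereal_sup_ubound; exists m => //=.
exact: leq_trans (leq_maxl _ _) im.
Qed.

Theorem theorem1 (R : realType) (g : forall n : nat, n.-tuple bool -> answer)
  (hMarkov : forall (d : measure_display) (T : measurableType d)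
      (P : probability T R) (X : int -> {RV P >-> bool}),
    stationary X -> ergodic X -> finite_order_markov X ->
    prob_answer X g YES n @[n --> \oo] --> 1%E)
  (hNotFM : forall (d : measure_display) (T : measurableType d)
      (P : probability T R) (X : int -> {RV P >-> bool}),
    stationary X -> ergodic X -> ~ finitarily_markovian X ->
    prob_answer X g NO n @[n --> \oo] --> 1%E) :
  exists (d : measure_display) (T : measurableType d)
      (P : probability T R) (X : int -> {RV P >-> bool}),
    [/\ stationary X, ergodic X,
        limn_esup (prob_answer X g YES) = 1%E &
        limn_esup (prob_answer X g NO) = 1%E].
Proof.
pose ans (b : bool) := if b then YES else NO.
(* [U (b, i)]: the answer [ans b] has probability above 1 - 1/(i+1) at some
   time n >= i. *)
pose U (bi : bool * nat) : set {mfun odometer >-> bool} := [set f |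
  exists2 n, (bi.2 <= n)%N &
    1 - bi.2.+1%:R^-1 < fine (prob_answer (factor R f) g (ans bi.1) n)].
have fineE f a n : (fine (prob_answer (factor R f) g a n))%:E =
    prob_answer (factor R f) g a n.
  by rewrite /prob_answer EFin_pr//; exact: (measurable_block _ _ [set s | g n s = a]).
have openU bi f : U bi f ->
    exists2 e : R, 0 < e & forall h, fdist R f h < e -> U bi h.
  move=> [n in_ fn].
  have [e e0 He] := @open_block_gt R 1 n [set s | g n s = ans bi.1] f _ fn.
  by exists e => // h /He hn; exists n.
have cvgU f b : prob_answer (factor R f) g (ans b) n @[n --> \oo] --> 1%E ->
    forall i, U (b, i) f.
  move=> cv i.
  have : \forall n \near \oo,
      ((1 - i.+1%:R^-1)%:E < prob_answer (factor R f) g (ans b) n)%E.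
    apply: (cv [set y | ((1 - i.+1%:R^-1)%:E < y)%E]); apply: open_nbhs_nbhs.
    split; first exact: open_ereal_gt_ereal.
    by rewrite /= lte_fin ltrBlDr ltrDl invr_gt0.
  move=> [N _ HN]; exists (maxn i N); first exact: leq_maxl.
  by rewrite -lte_fin fineE; apply: HN => /=; exact: leq_maxr.
have denseU bi f (e : R) : is_periodic f -> 0 < e ->
    exists h, [/\ is_periodic h, fdist R f h < e & U bi h].
  move: bi => [[|] i] pf e0.
    exists f; split; rewrite ?fdistxx//.
    by apply: cvgU; apply: hMarkov; [exact: stationary_factor|
      exact: ergodic_factor|exact: periodic_markov].
  (* NO: the condition holds at a nearby h of full support and, being open, at
     periodic functions close enough to h. *)
  have [|h [lh fh fullh]] := @full_support_dense R f (e / 2) pf.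
    by rewrite divr_gt0.
  have Uh : U (false, i) h.
    apply: cvgU; apply: hNotFM; [exact: stationary_factor|exact: ergodic_factor|].
    exact: rigid_not_finitarily_markovian.
  have [c c0 Hc] := openU _ _ Uh.
  have [|h' [ph' hh']] := lh (Num.min c (e / 2)).
    by rewrite lt_min c0 divr_gt0.
  move: hh'; rewrite lt_min => /andP[hc he].
  exists h'; split=> //; last exact: Hc.
  by rewrite (le_lt_trans (fdist_triangle R f h h'))//; lra.
pose f0 : {mfun odometer >-> bool} := cst false.
have [|h [_ _ Uh]] := @baire R _ U openU denseU f0 1 _ ltr01.
  by exists 0%N.
have lim b : limn_esup (prob_answer (factor R h) g (ans b)) = 1%E.
  apply: limn_esup_eq1 => [n|i].
    by apply: probability_le1; exact: (measurable_block _ _ [set s | g n s = ans b]).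
  by have [n in_ hn] := Uh (b, i); exists n; rewrite // -fineE lte_fin.
exists _, odometer, (haar R), (factor R h); split.
- exact: stationary_factor.
- exact: ergodic_factor.
- exact: (lim true).
- exact: (lim false).
Qed.
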